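(* Let $n\in\mathbb{N}=\{1,2,3,\dots\}$. The following data $\mathcal{A}=\mathcal{A}_n$ form a (strict) $2$-category: - there is one object $\mathtt{i}$; - the $1$-morphisms are the elements of the symmetric group $S_n$, composed as in $S_n$, and the identity $1$-morphism is $\mathrm{id}_{\mathbf{n}}\in S_n$; - for $\pi,\sigma\in S_n$, $\mathrm{Hom}_{\mathcal{A}}(\pi,\sigma)$ is the set of all $\alpha\in\mathbf{B}_n$ such that $\alpha\subseteq\pi\cap\sigma$; - the vertical composition of $\alpha\in\mathrm{Hom}_{\mathcal{A}}(\pi,\sigma)$ and $\beta\in\mathrm{Hom}_{\mathcal{A}}(\sigma,\tau)$ is $\beta\circ_1\alpha:=\beta\cap\alpha$; - the identity $2$-morphism in $\mathrm{Hom}_{\mathcal{A}}(\pi,\pi)$ is $\pi$; - the horizontal composition of $\alpha\in\mathrm{Hom}_{\mathcal{A}}(\pi,\sigma)$ and $\beta\in\mathrm{Hom}_{\mathcal{A}}(\tau,\rho)$ is $\beta\circ_0\alpha:=\beta\alpha$, the usual composition of binary relations.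
   Context: $\mathbf{n}=\{1,\dots,n\}$ and $S_n$ is the group of bijections of $\mathbf{n}$ under composition. $\mathbf{B}_n=2^{\mathbf{n}\times\mathbf{n}}$ is the monoid of all binary relations on $\mathbf{n}$, with $\beta\alpha=\{(z,x):\exists y\in\mathbf{n},\ (z,y)\in\beta,\ (y,x)\in\alpha\}$; a permutation $\pi\in S_n$ is identified with the relation $\{(\pi(x),x):x\in\mathbf{n}\}$. A (strict) $2$-category is a category enriched over the category of small categories. *)

(* Defs.v *)
From mathcomp Require Import all_boot all_fingroup.

Set Implicit Arguments.
Unset Strict Implicit.
Unset Printing Implicit Defensive.

(* Throughout, a record of raw data is kept apart from the axioms it has to   *)
(* satisfy, so that "these data form a ..." is a proposition.                 *)

Record cat_data := CatData {
  ob :> Type;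
  hom : ob -> ob -> Type;
  idm : forall x, hom x x;
  comp : forall x y z, hom y z -> hom x y -> hom x z
}.
Arguments hom {c} x y.
Arguments idm {c} x.
Arguments comp {c x y z} g f.

Record is_category (C : cat_data) : Prop := IsCategory {
  compA : forall (x y z t : C) (h : hom z t) (g : hom y z) (f : hom x y),
    comp h (comp g f) = comp (comp h g) f;
  comp1m : forall (x y : C) (f : hom x y), comp (idm y) f = f;
  compm1 : forall (x y : C) (f : hom x y), comp f (idm x) = f
}.

Record functor_data (C D : cat_data) := FunctorData {
  fob :> C -> D;
  fhom : forall x y : C, hom x y -> hom (fob x) (fob y)
}.
Arguments fhom {C D} f {x y} a.

Record is_functor (C D : cat_data) (F : functor_data C D) : Prop := IsFunctor {
  fhom1 : forall x : C, fhom F (idm x) = idm (F x);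
  fhomM : forall (x y z : C) (g : hom y z) (f : hom x y),
    fhom F (comp g f) = comp (fhom F g) (fhom F f)
}.

Definition functor_id (C : cat_data) : functor_data C C :=
  FunctorData (fun _ _ f => f).

Definition functor_comp (C D E : cat_data)
    (G : functor_data D E) (F : functor_data C D) : functor_data C E :=
  FunctorData (fun _ _ f => fhom G (fhom F f)).

Definition cat_one : cat_data :=
  @CatData unit (fun _ _ => unit) (fun _ => tt) (fun _ _ _ _ _ => tt).

Definition cat_prod (C D : cat_data) : cat_data :=
  @CatData (C * D)
    (fun p q => (hom p.1 q.1 * hom p.2 q.2)%type)
    (fun p => (idm p.1, idm p.2))
    (fun _ _ _ g f => (comp g.1 f.1, comp g.2 f.2)).

Definition functor_prod (C C' D D' : cat_data)
    (F : functor_data C C') (G : functor_data D D') :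
    functor_data (cat_prod C D) (cat_prod C' D') :=
  @FunctorData (cat_prod C D) (cat_prod C' D') (fun p => (F p.1, G p.2))
    (fun _ _ f => (fhom F f.1, fhom G f.2)).

Definition functor_fst (C D : cat_data) : functor_data (cat_prod C D) C :=
  @FunctorData (cat_prod C D) C fst (fun _ _ f => f.1).

Definition functor_snd (C D : cat_data) : functor_data (cat_prod C D) D :=
  @FunctorData (cat_prod C D) D snd (fun _ _ f => f.2).

Definition functor_assoc (C D E : cat_data) :
    functor_data (cat_prod (cat_prod C D) E) (cat_prod C (cat_prod D E)) :=
  @FunctorData (cat_prod (cat_prod C D) E) (cat_prod C (cat_prod D E))
    (fun p => (p.1.1, (p.1.2, p.2))) (fun _ _ f => (f.1.1, (f.1.2, f.2))).

(* A strict 2-category is a category enriched over (Cat, cat_prod, cat_one):  *)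
(* the objects of Hom x y are the 1-morphisms, its morphisms the 2-morphisms, *)
(* its composition the vertical one; Comp is composition of 1-morphisms on    *)
(* objects and horizontal composition of 2-morphisms on morphisms.            *)

Record two_cat_data := TwoCatData {
  obj : Type;
  Hom : obj -> obj -> cat_data;
  Id : forall x, functor_data cat_one (Hom x x);
  Comp : forall x y z, functor_data (cat_prod (Hom y z) (Hom x y)) (Hom x z)
}.
Arguments Hom {t} x y.
Arguments Id {t} x.
Arguments Comp {t} x y z.

(* The last three fields are equalities of functors, hence assert equality    *)
(* on both 1-morphisms and 2-morphisms.                                       *)
Record is_two_category (A : two_cat_data) : Prop := IsTwoCategory {
  Hom_category : forall x y : obj A, is_category (Hom x y);
  Id_functor : forall x : obj A, is_functor (Id x);
  Comp_functor : forall x y z : obj A, is_functor (Comp x y z);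
  CompA : forall x y z t : obj A,
    functor_comp (Comp x y t)
      (functor_prod (Comp y z t) (functor_id (Hom x y)))
    = functor_comp (Comp x z t)
        (functor_comp (functor_prod (functor_id (Hom z t)) (Comp x y z))
          (functor_assoc (Hom z t) (Hom y z) (Hom x y)));
  Comp1m : forall x y : obj A,
    functor_comp (Comp x y y) (functor_prod (Id y) (functor_id (Hom x y)))
    = functor_snd cat_one (Hom x y);
  Compm1 : forall x y : obj A,
    functor_comp (Comp x x y) (functor_prod (functor_id (Hom x y)) (Id x))
    = functor_fst (Hom x y) cat_one
}.

Section Relations.
Variable n : nat.

Definition brel : Type := {set 'I_n * 'I_n}.

Definition brel_comp (b a : brel) : brel :=
  [set p | [exists y, ((p.1, y) \in b) && ((y, p.2) \in a)]].

Definition brel_of_perm (p : 'S_n) : brel := [set (p x, x) | x : 'I_n].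

(* (p * q)%g means "first p, then q": this is x |-> q (p x).                  *)
Definition perm_comp (q p : 'S_n) : 'S_n := (p * q)%g.

Definition hom2 (p q : 'S_n) : Type :=
  {a : brel | a \subset brel_of_perm p :&: brel_of_perm q}.

(* The one-object 2-category data on S_n and hom2 with given identity         *)
(* 2-morphisms, vertical and horizontal compositions.                         *)
Definition perm_two_cat_data
    (id2 : forall p : 'S_n, hom2 p p)
    (vcomp : forall p q r : 'S_n, hom2 q r -> hom2 p q -> hom2 p r)
    (hcomp : forall p q r s : 'S_n,
       hom2 r s -> hom2 p q -> hom2 (perm_comp r p) (perm_comp s q)) :
    two_cat_data :=
  let H : cat_data := CatData id2 vcomp in
  @TwoCatData unit (fun _ _ => H)
    (fun _ => @FunctorData cat_one H (fun _ => 1%g) (fun _ _ _ => id2 1%g))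
    (fun _ _ _ => @FunctorData (cat_prod H H) H
       (fun p => perm_comp p.1 p.2)
       (fun p q f => hcomp p.2 q.2 p.1 q.1 f.1 f.2)).

End Relations.

(* Main.v *)
Require Import Defs.
From mathcomp Require Import all_boot all_fingroup.
From Stdlib Require Import FunctionalExtensionality.

(** Vertical composition is intersection, so it is associative, and the graph
    of [p] is neutral because it contains every 2-morphism into or out of [p].
    Horizontal composition is well defined because composition of relations
    is monotone ([brel_compS]) and sends graphs to graphs ([brel_of_permM]);
    it is associative and unital because composition of relations is.

    The one law with content is interchange, that is, functoriality of
    horizontal composition.  Composition of arbitrary relations distributes
    over intersections only up to inclusion: a pair in both [b' a'] and [b a]
    may come with two different middle points.  Here [a] and [a'] both lie in
    the graph of the 1-morphism [q] through which they are composed, so a pair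
    [(z, x)] has the single possible middle point [q x]
    ([brel_comp_interchange]).

    The enriched associativity and unit laws are equalities of functors whose
    object parts agree only propositionally, so that their morphism parts have
    different types.  Since a 2-morphism is determined by its underlying
    relation, it is enough to compare 1-morphisms and underlying relations
    ([functor_to_rel_eq]). *)

(** * Relations and graphs of permutations *)

Section Relations.
Context {n : nat}.
Implicit Types (p q : 'S_n) (a b c : brel n).

Lemma brel_compP b a z x :
  reflect (exists2 y, (z, y) \in b & (y, x) \in a) ((z, x) \in brel_comp b a).
Proof.
rewrite inE; apply: (iffP existsP) => [[y /andP[]]|[y zy yx]]; exists y => //.
exact/andP.
Qed.

Lemma mem_brel_of_perm p z x : ((z, x) \in brel_of_perm p) = (z == p x).
Proof. by apply/imsetP/eqP => [[y _ [-> ->]]|->] //; exists x. Qed.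

Lemma brel_compA c b a :
  brel_comp c (brel_comp b a) = brel_comp (brel_comp c b) a.
Proof.
apply/setP => -[z x]; apply/brel_compP/brel_compP.
  case=> y zy /brel_compP[w yw wx]; exists w => //.
  by apply/brel_compP; exists y.
case=> y /brel_compP[w zw wy] yx; exists w => //.
by apply/brel_compP; exists y.
Qed.

Lemma brel_comp1r a : brel_comp (brel_of_perm 1%g) a = a.
Proof.
apply/setP => -[z x]; apply/brel_compP/idP.
  by case=> y; rewrite mem_brel_of_perm perm1 => /eqP->.
by exists z; rewrite ?mem_brel_of_perm ?perm1.
Qed.

Lemma brel_compr1 a : brel_comp a (brel_of_perm 1%g) = a.
Proof.
apply/setP => -[z x]; apply/brel_compP/idP.
  by case=> y zy; rewrite mem_brel_of_perm perm1 => /eqP<-.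
by exists x; rewrite ?mem_brel_of_perm ?perm1.
Qed.

Lemma brel_compS b b' a a' :
  b \subset b' -> a \subset a' -> brel_comp b a \subset brel_comp b' a'.
Proof.
move=> /subsetP sb /subsetP sa; apply/subsetP => -[z x] /brel_compP[y zy yx].
by apply/brel_compP; exists y; [apply: sb | apply: sa].
Qed.

Lemma brel_of_permM q p :
  brel_of_perm (perm_comp q p) = brel_comp (brel_of_perm q) (brel_of_perm p).
Proof.
apply/setP => -[z x]; rewrite mem_brel_of_perm permM.
apply/idP/brel_compP => [zx|[y]].
  by exists (p x); rewrite mem_brel_of_perm.
by rewrite !mem_brel_of_perm => zy /eqP<-.
Qed.

(** Without the two inclusions only the inclusion from left to right holds;
    they force the middle point above [x] to be [q x] on both sides. *)
Lemma brel_comp_interchange q b b' a a' :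
  a \subset brel_of_perm q -> a' \subset brel_of_perm q ->
  brel_comp (b' :&: b) (a' :&: a) = brel_comp b' a' :&: brel_comp b a.
Proof.
move=> /subsetP sa /subsetP sa'; apply/setP => -[z x].
rewrite in_setI; apply/brel_compP/andP.
  case=> y /setIP[zy' zy] /setIP[yx' yx].
  by split; apply/brel_compP; exists y.
case=> /brel_compP[y zy yx] /brel_compP[w zw wx].
have /eqP yq : y == q x by rewrite -mem_brel_of_perm sa'.
have /eqP wq : w == q x by rewrite -mem_brel_of_perm sa.
move: zy yx zw wx; rewrite yq wq => zy yx zw wx.
by exists (q x); apply/setIP.
Qed.

End Relations.

(** * Operations on 2-morphisms *)

Section TwoMorphisms.
Context {n : nat}.
Implicit Types p q r s : 'S_n.

Definition Hom2 p q (a : brel n)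
    (sub_a : a \subset brel_of_perm p :&: brel_of_perm q) : hom2 p q :=
  exist (fun a : brel n => a \subset brel_of_perm p :&: brel_of_perm q)
    a sub_a.

Lemma hom2_subl p q (a : hom2 p q) : sval a \subset brel_of_perm p.
Proof. by have := svalP a; rewrite subsetI => /andP[]. Qed.

Lemma hom2_subr p q (a : hom2 p q) : sval a \subset brel_of_perm q.
Proof. by have := svalP a; rewrite subsetI => /andP[]. Qed.

Lemma id2_subset p :
  brel_of_perm p \subset brel_of_perm p :&: brel_of_perm p.
Proof. by rewrite setIid. Qed.

Definition id2 p : hom2 p p := Hom2 _ _ _ (id2_subset p).

Lemma vcomp_subset p q r (b : hom2 q r) (a : hom2 p q) :
  sval b :&: sval a \subset brel_of_perm p :&: brel_of_perm r.
Proof. by rewrite setIC setISS ?hom2_subl ?hom2_subr. Qed.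

Definition vcomp p q r (b : hom2 q r) (a : hom2 p q) : hom2 p r :=
  Hom2 _ _ _ (vcomp_subset p q r b a).

Lemma hcomp_subset p q r s (b : hom2 r s) (a : hom2 p q) :
  brel_comp (sval b) (sval a)
    \subset brel_of_perm (perm_comp r p) :&: brel_of_perm (perm_comp s q).
Proof.
by rewrite !brel_of_permM subsetI !brel_compS ?hom2_subl ?hom2_subr.
Qed.

Definition hcomp p q r s (b : hom2 r s) (a : hom2 p q) :
    hom2 (perm_comp r p) (perm_comp s q) :=
  Hom2 _ _ _ (hcomp_subset p q r s b a).

End TwoMorphisms.

(** * The 2-category *)

Section TwoCategory.
Context {n : nat}.

Definition perm_cat : cat_data := CatData (@id2 n) (@vcomp n).

Lemma perm_cat_category : is_category perm_cat.
Proof.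
split=> [p q r s h g f|p q f|p q f]; apply: val_inj => /=.
- exact: setIA.
- exact/setIidPr/hom2_subr.
- exact/setIidPl/hom2_subl.
Qed.

(** Comparing underlying relations avoids transporting 2-morphisms along the
    equalities between their sources and targets. *)
Lemma functor_to_rel_eq (C : cat_data) (F G : functor_data C perm_cat) :
    (forall x, F x = G x) ->
    (forall x y (f : hom x y), sval (fhom F f) = sval (fhom G f)) ->
  F = G.
Proof.
case: F G => [fo fh] [go gh] /= eq_ob.
have {eq_ob} eq_ob : fo = go by apply: functional_extensionality.
case: go / eq_ob gh => gh eq_hom; congr FunctorData.
do 3![apply: functional_extensionality_dep => ?].
exact/val_inj/eq_hom.
Qed.

Lemma perm_two_cat_two_category :
  is_two_category (perm_two_cat_data (@id2 n) (@vcomp n) (@hcomp n)).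
Proof.
split=> *; rewrite /=.
- exact: perm_cat_category.
- by split=> *; apply: val_inj; rewrite //= setIid.
- split=> [p | p q r g f]; apply: val_inj => /=.
    by rewrite brel_of_permM.
  (* All the middle points are read off the graph of the 1-morphism [q.2]. *)
  exact: (brel_comp_interchange q.2 _ _ _ _ (hom2_subr _ _ _)
            (hom2_subl _ _ _)).
- apply: functor_to_rel_eq => [p|p q f] /=; first exact: mulgA.
  by rewrite brel_compA.
- apply: functor_to_rel_eq => [p|p q f] /=; first exact: mulg1.
  exact: brel_comp1r.
- apply: functor_to_rel_eq => [p|p q f] /=; first exact: mul1g.
  exact: brel_compr1.
Qed.

End TwoCategory.

Theorem proposition1 (n : nat) (n_gt0 : 0 < n) :
  exists (id2 : forall p : 'S_n, hom2 p p)
         (vcomp : forall p q r : 'S_n, hom2 q r -> hom2 p q -> hom2 p r)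
         (hcomp : forall p q r s : 'S_n,
            hom2 r s -> hom2 p q -> hom2 (perm_comp r p) (perm_comp s q)),
    [/\ forall p : 'S_n, sval (id2 p) = brel_of_perm p,
        forall (p q r : 'S_n) (b : hom2 q r) (a : hom2 p q),
          sval (vcomp p q r b a) = sval b :&: sval a,
        forall (p q r s : 'S_n) (b : hom2 r s) (a : hom2 p q),
          sval (hcomp p q r s b a) = brel_comp (sval b) (sval a)
      & is_two_category (perm_two_cat_data id2 vcomp hcomp)].
Proof.
exists id2, vcomp, hcomp; split=> //.
exact: perm_two_cat_two_category.
Qed.
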